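(* Let $z=x+iy\in\mathbb C$ with $\arg z\in(-\pi,\pi)$, let $\lambda_1>0$, and let $\mu_z\in\mathbb R$ with $\mu_z>-\lambda_1$. Then there is a constant $c(z,\lambda_1,\mu_z)<1$ such that the following holds for every positive definite Hermitian operator $A$ on a finite-dimensional complex inner product space $V$ with smallest eigenvalue $\lambda_1$ and largest eigenvalue $\lambda_N$ (the constant being independent of $\lambda_N$). Put $G_z(A,\mu_z):=(\mu_zI+A)^{-1}(zI+A)$ and $G_z(\lambda,\mu_z):=\frac{z+\lambda}{\mu_z+\lambda}$, let $\mathsf a:=G_z(\lambda_1,\mu_z)$, $\mathsf b:=G_z(\lambda_N,\mu_z)$, $\mathsf c:=\tfrac12(\mathsf a+\mathsf b)$, $\mathsf d:=i(\mathsf b-\mathsf a)$, and let $\alpha_z:=1/(\mathsf c+s\mathsf d)$, where $s\in\mathbb R$ minimizes $R(s):=\bigl|1-\frac{\mathsf a}{\mathsf c+s\mathsf d}\bigr|^2$. Then the error reduction factor of the preconditioned Richardson iteration $w^{n+1}=(I-\alpha_z G_z)w^n+\alpha_z\widetilde g_z$ satisfies $$\widetilde\varepsilon_z:=\|I-\alpha_zG_z(A,\mu_z)\|=|1-\alpha_z\mathsf a|\le c(z,\lambda_1,\mu_z)<1.$$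
   Context: $\|\cdot\|$ is the norm of the inner product on $V$ and the induced operator norm. The equation $(zI+A)w=g$ is preconditioned by $B_z=(\mu_zI+A)^{-1}$, giving $G_zw=\widetilde g_z:=B_zg$ with $G_z=G_z(A,\mu_z)=B_z(zI+A)$. When $\mathsf a,\mathsf b$ are linearly independent over $\mathbb R$, the minimizing $s$ is $s_{\min}=-\mathsf f_1\pm\sqrt{\mathsf f_1^2-\mathsf f_2}$, the sign $\pm$ being that of $\operatorname{Re}(\mathsf a\overline{\mathsf d})$, where $\mathsf f_1=\frac{2\operatorname{Re}(\mathsf a\overline{\mathsf c})-|\mathsf a|^2}{2\operatorname{Re}(\mathsf a\overline{\mathsf d})}$ and $\mathsf f_2=\frac{2\mathsf f_1\operatorname{Re}(\mathsf c\overline{\mathsf d})-|\mathsf c|^2}{|\mathsf d|^2}$. The minimization of $R$ is over those $s\in\mathbb R$ with $\mathsf c+s\mathsf d\neq0$. *)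

(* Defs.v *)
From HB Require Import structures.
From mathcomp Require Import all_boot all_order all_algebra.
From mathcomp Require Import sesquilinear complex.
From mathcomp Require Import classical_sets reals trigo.

Set Implicit Arguments.
Unset Strict Implicit.
Unset Printing Implicit Defensive.

Import Order.TTheory GRing.Theory Num.Theory.

Local Open Scope classical_set_scope.
Local Open Scope ring_scope.
Local Open Scope complex_scope.

(* The complex numbers are R[i] for R : realType; a real x is embedded as x%:C,
   and Normc.normc : R[i] -> R is the real-valued modulus. *)

(* arg z is undefined at z = 0, hence the first conjunct. *)
Definition is_arg (R : realType) (z : R[i]) (t : R) : Prop :=
  z != 0 /\ z = (Normc.normc z)%:C * (cos t +i* sin t).

Section InnerProductSpace.
Context {R : realType} {V : vectType R[i]}.
Variable dot : {dot V for @Num.conj R[i]}.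

(* dot v v is a nonnegative real element of R[i]; Re extracts it. *)
Definition ipnorm (v : V) : R := Num.sqrt (complex.Re (dot v v)).

(* The set is bounded because V is finite-dimensional. *)
Definition opnorm (f : 'End(V)) : R :=
  sup [set ipnorm (f v) | v in [set v | ipnorm v <= 1]].

Definition is_hermitian_op (A : 'End(V)) : Prop :=
  forall u v, dot (A u) v = dot u (A v).

(* The order of R[i] makes 0 < w mean that w is real and positive. *)
Definition is_posdef_op (A : 'End(V)) : Prop :=
  forall v, v != 0 -> 0 < dot (A v) v.

End InnerProductSpace.

Section Eigenvalues.
Context {R : realType} {V : vectType R[i]}.

Definition is_smallest_eigenvalue (A : 'End(V)) (l : R) : Prop :=
  passmx.leigenvalue A l%:C /\ forall w, passmx.leigenvalue A w -> l%:C <= w.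

Definition is_largest_eigenvalue (A : 'End(V)) (l : R) : Prop :=
  passmx.leigenvalue A l%:C /\ forall w, passmx.leigenvalue A w -> w <= l%:C.

End Eigenvalues.

Section Richardson.
Context {R : realType} {V : vectType R[i]}.

(* inv_lfun is total; it is the two-sided inverse as soon as its argument is
   injective. *)
Definition precond (mu : R) (A : 'End(V)) : 'End(V) :=
  (inv_lfun (mu%:C *: \1 + A))%VF.

Definition precond_op (z : R[i]) (mu : R) (A : 'End(V)) : 'End(V) :=
  (precond mu A \o (z *: \1 + A))%VF.

Definition iteration_op (alpha : R[i]) (G : 'End(V)) : 'End(V) :=
  (\1 - alpha *: G)%VF.

Definition richardson_step (alpha : R[i]) (G : 'End(V)) (gt w : V) : V :=
  iteration_op alpha G w + alpha *: gt.

Lemma richardson_error (alpha : R[i]) (G : 'End(V)) (gt wsol w : V) :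
  G wsol = gt ->
  richardson_step alpha G gt w - wsol = iteration_op alpha G (w - wsol).
Proof.
move=> <-; rewrite /richardson_step /iteration_op.
rewrite !(add_lfunE, opp_lfunE, scale_lfunE, id_lfunE) linearB scalerBr opprB.
by rewrite -!addrA; congr (_ + _); rewrite addrA [RHS]addrC [- _ + _]addrC.
Qed.

Definition error_reduction_factor (dot : {dot V for @Num.conj R[i]})
    (alpha : R[i]) (G : 'End(V)) : R :=
  opnorm dot (iteration_op alpha G).

End Richardson.

Section StepSize.
Context {R : realType}.

Definition Gsymbol (z : R[i]) (mu lambda : R) : R[i] :=
  (z + lambda%:C) / (mu%:C + lambda%:C).

(* The points c + s d of the perpendicular bisector of a and b. *)
Definition bisector (a b : R[i]) (s : R) : R[i] :=
  (a + b) / 2 + s%:C * ('i%C * (b - a)).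

Definition Robj (a b : R[i]) (s : R) : R :=
  Normc.normc (1 - a / bisector a b s) ^+ 2.

Definition minimizes_Robj (a b : R[i]) (s : R) : Prop :=
  bisector a b s != 0 /\
  forall t, bisector a b t != 0 -> Robj a b s <= Robj a b t.

End StepSize.

(* Main.v *)
Require Import Defs.
From HB Require Import structures.
From mathcomp Require Import all_boot all_order all_algebra.
From mathcomp Require Import sesquilinear complex spectral.
From mathcomp Require Import classical_sets reals trigo.
From mathcomp Require Import ring lra.

Set Implicit Arguments.
Unset Strict Implicit.
Unset Printing Implicit Defensive.

Import Order.TTheory GRing.Theory Num.Theory.

Local Open Scope ring_scope.
Local Open Scope complex_scope.

(** Write p = c + s d for the points of the perpendicular bisector of a and b,
    so that R(s) = |p - a|^2 / |p|^2.

    Uniform bound.  Since z is off the closed negative real axis, either a is not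
    real or a > 0, and the bisector of a and 1 contains a point p0 with
    |p0 - a| < |p0| ([Gsymbol_gain_gt0]).  The constant is
    c = |1 - a / p0| = |p0 - a| / |p0| < 1.  As lambda_N varies, b runs through
    the segment from a to 1 ([Gsymbol_segment]): b = t a + (1 - t) with
    0 <= t <= 1.  For a fixed parameter s, the point of the bisector of a and b
    is the image of p0 under the dilation of centre a and ratio 1 - t, that is,
    q = t a + (1 - t) p0.  The disc of centre q through a lies in the disc of
    centre p0 through a, which misses 0, and this gives
    |q - a| / |q| <= |p0 - a| / |p0| ([bisector_ratio_le]).  A minimizing s does
    at least as well.

    Existence of a minimizer.  1 - R(s) is the quotient of an affine function,
    the gain |p|^2 - |p - a|^2, by the quadratic function |p|^2; when the gain
    is positive somewhere, the quotient attains its maximum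
    ([quotient_maximizer], [minimizes_Robj_exists]).

    Operator norm.  With v = (mu + A) w, the vector (I - alpha G) v is an affine
    function of A applied to w ([iteration_shiftE]), so the norm estimate
    compares two affine functions of the Hermitian operator A.  Such a
    comparison need only be made on the eigenvalues ([hermitian_affine_le]),
    where it follows from the cases lambda_1 and lambda_N by convexity
    ([affine_norm_le]); these two cases agree because p is equidistant from a
    and b.  The bound is attained at an eigenvector for lambda_1. *)

(** * The optimal step size *)

(** The case Q != 0 is solved in the variable u: there E is
    al * u ^+ 2 + be * u + ga with al, ga > 0, and u / E is largest on u > 0 at
    u = sqrt (ga / al). *)
Lemma quotient_maximizer (R : rcfType) (P Q e0 e1 e2 s0 : R)
    (u := fun t => P + 2 * Q * t) (E := fun t => e0 + e1 * t + e2 * t ^+ 2) :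
    0 < e2 -> (forall t, u t = 0 -> 0 < E t) -> 0 < u s0 ->
  exists2 s, 0 < u s & forall t, u t * E s <= u s * E t.
Proof.
move=> e2_gt0 E_gt0 us0; have [Q0|Q0] := eqVneq Q 0.
  have uE t : u t = P by rewrite /u Q0; ring.
  (* the numerator is constant, so the vertex of E is optimal *)
  exists (- e1 / (2 * e2)) => [|t]; first by rewrite uE -(uE s0).
  have P0 : 0 < P by rewrite -(uE s0).
  rewrite !uE ler_pM2l // -subr_ge0.
  have -> : E t - E (- e1 / (2 * e2)) = e2 * (t + e1 / (2 * e2)) ^+ 2.
    by rewrite /E; field; rewrite lt0r_neq0.
  by rewrite mulr_ge0 ?sqr_ge0 // ltW.
pose al := e2 / (4 * Q ^+ 2); pose ga := E (- P / (2 * Q)).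
pose be := e1 / (2 * Q) - P * e2 / (2 * Q ^+ 2).
have EE t : E t = al * u t ^+ 2 + be * u t + ga.
  by rewrite /E /al /be /ga /E /u; field.
have al_gt0 : 0 < al by rewrite divr_gt0 // mulr_gt0 // exprn_even_gt0.
have ga_gt0 : 0 < ga by apply: E_gt0; rewrite /u; field.
pose w := Num.sqrt (ga / al).
have w_gt0 : 0 < w by rewrite sqrtr_gt0 divr_gt0.
have gaE : ga = al * w ^+ 2.
  by rewrite sqr_sqrtr ?(ltW (divr_gt0 _ _)) // [RHS]mulrC divfK ?lt0r_neq0.
have usE : u ((w - P) / (2 * Q)) = w by rewrite /u; field.
exists ((w - P) / (2 * Q)) => [|t]; rewrite usE // -subr_ge0.
have -> : w * E t - u t * E ((w - P) / (2 * Q)) = al * w * (u t - w) ^+ 2.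
  by rewrite !EE usE gaE; ring.
by rewrite mulr_ge0 ?sqr_ge0 // ltW // mulr_gt0.
Qed.

Section StepSize.
Variable R : realType.
Implicit Types (a b z p : R[i]) (s t : R).
Local Notation normc := Normc.normc.

Lemma normc_ge0 z : 0 <= normc z.
Proof. by case: z => x y; apply: sqrtr_ge0. Qed.

Lemma normc_gt0 z : (0 < normc z) = (z != 0).
Proof.
rewrite lt0r normc_ge0 andbT; congr negb; apply/eqP/eqP => [|->].
  exact: Normc.eq0_normc.
exact: Normc.normc0.
Qed.

Lemma sqr_normc_ReIm z : normc z ^+ 2 = complex.Re z ^+ 2 + complex.Im z ^+ 2.
Proof. by case: z => x y; rewrite sqr_sqrtr // addr_ge0 ?sqr_ge0. Qed.

Lemma normc_nng t : 0 <= t -> normc t%:C = t.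
Proof. by move=> t0; rewrite /= expr0n addr0 sqrtr_sqr ger0_norm. Qed.

(** The numerator |p|^2 - |p - a|^2 of 1 - R(s), at the point p of parameter s
    of the bisector of a and b.  It is written as the affine function
    Re (a conj b) + 2 Im (a conj b) s of s, which makes it total in s; [gainE]
    gives its meaning. *)
Definition gain a b s : R :=
  complex.Re a * complex.Re b + complex.Im a * complex.Im b
  + 2 * (complex.Im a * complex.Re b - complex.Re a * complex.Im b) * s.

Lemma bisectorE a b s :
  bisector a b s =
    ((complex.Re a + complex.Re b) / 2 - s * (complex.Im b - complex.Im a)) +i*
    ((complex.Im a + complex.Im b) / 2 + s * (complex.Re b - complex.Re a)).
Proof.
rewrite /bisector; case: a b => [a1 a2] [b1 b2].
have -> : (2 : R[i])^-1 = 2^-1 +i* 0.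
  by rewrite -[RHS]/(2^-1)%:C fmorphV rmorph_nat.
by simpc; apply/eqP; rewrite eq_complex /=; apply/andP; split; apply/eqP; ring.
Qed.

Lemma gainE a b s :
  gain a b s = normc (bisector a b s) ^+ 2 - normc (bisector a b s - a) ^+ 2.
Proof.
rewrite !sqr_normc_ReIm bisectorE /gain; case: a b => [a1 a2] [b1 b2] /=.
by field.
Qed.

Lemma gain_bisector_neq0 a b s : 0 < gain a b s -> bisector a b s != 0.
Proof.
rewrite gainE; apply: contraTneq => ->.
by rewrite Normc.normc0 expr0n sub0r oppr_gt0 -leNgt sqr_ge0.
Qed.

Lemma normc_one_sub_div a p : p != 0 ->
  normc (1 - a / p) = normc (p - a) / normc p.
Proof.
move=> p0; rewrite -Normc.normcV -Normc.normcM; congr normc.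
by rewrite mulrBl divff.
Qed.

Lemma RobjE a b s : bisector a b s != 0 ->
  Robj a b s = 1 - gain a b s / normc (bisector a b s) ^+ 2.
Proof.
move=> p0; rewrite /Robj normc_one_sub_div // gainE; field.
by rewrite gt_eqF // normc_gt0.
Qed.

Lemma gain_gt0E a b s : bisector a b s != 0 ->
  (0 < gain a b s) = (normc (1 - a / bisector a b s) < 1).
Proof.
move=> p0; rewrite normc_one_sub_div // ltr_pdivrMr ?normc_gt0 // mul1r.
by rewrite gainE subr_gt0 ltr_sqr ?nnegrE ?normc_ge0.
Qed.

Lemma gain_neq0 a b s : 0 < gain a b s -> a != 0.
Proof.
apply: contraTneq => ->.
by rewrite /gain /= !mul0r subrr mulr0 mul0r !addr0 ltxx.
Qed.

Lemma minimizes_Robj_exists a b s0 : 0 < gain a b s0 ->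
  exists s, minimizes_Robj a b s.
Proof.
move=> g0; have a0 := gain_neq0 g0; pose E s := normc (bisector a b s) ^+ 2.
suff [s gs le_s] : exists2 s, 0 < gain a b s &
    forall t, gain a b t * E s <= gain a b s * E t.
  have E_gt0 t : bisector a b t != 0 -> 0 < E t.
    by move=> ?; rewrite exprn_gt0 ?normc_gt0.
  have ps := gain_bisector_neq0 gs; exists s; split=> // t pt.
  rewrite !RobjE // lerD2l lerN2 ler_pdivrMr ?E_gt0 // mulrAC.
  by rewrite ler_pdivlMr ?E_gt0.
have [ab|ab] := eqVneq a b.
  (* the bisector degenerates to the point a, and R is constant *)
  by exists s0 => // t; rewrite /E /gain /bisector -ab subrr !mulr0; lra.
have D_gt0 : 0 < normc (b - a) ^+ 2.
  by rewrite exprn_gt0 ?normc_gt0 // subr_eq0 eq_sym.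
pose e0 := normc (bisector a b 0) ^+ 2.
pose e1 := normc (bisector a b 1) ^+ 2 - e0 - normc (b - a) ^+ 2.
have EE t : E t = e0 + e1 * t + normc (b - a) ^+ 2 * t ^+ 2.
  rewrite /e1 /e0 /E !sqr_normc_ReIm !bisectorE.
  case: a b {a0 g0 E ab D_gt0 e0 e1} => [a1 a2] [b1 b2] /=.
  by field.
(* where the gain vanishes, p = 0 would force |p - a| = 0, that is a = 0 *)
have E_gt0 t : gain a b t = 0 -> 0 < E t.
  move=> g; rewrite /E lt0r sqr_ge0 andbT sqrf_eq0 gt_eqF // normc_gt0.
  apply: contraPneq g => p0; rewrite gainE p0 Normc.normc0 expr0n !sub0r.
  by apply/eqP; rewrite oppr_eq0 sqrf_eq0 gt_eqF // normc_gt0 oppr_eq0.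
have [t gt|s gs le_s] := @quotient_maximizer R
    (complex.Re a * complex.Re b + complex.Im a * complex.Im b)
    (complex.Im a * complex.Re b - complex.Re a * complex.Im b)
    e0 e1 _ s0 D_gt0 _ g0.
  by rewrite -EE; apply: E_gt0.
by exists s => // t; rewrite !EE; apply: le_s.
Qed.

(** As b moves along the segment from 1 to a, the bisector point q of fixed
    parameter s is the image of p under the dilation of centre a and ratio
    1 - t; the ratio |q - a| / |q| is then at most |p - a| / |p|. *)
Lemma bisector_ratio_le a s t (b := t%:C * a + (1 - t)%:C)
    (p := bisector a 1 s) (q := bisector a b s) :
    0 <= t <= 1 -> 0 < gain a 1 s ->
  q != 0 /\ normc (1 - a / q) <= normc (1 - a / p).
Proof.
move=> /andP[t0 t1] g; have p0 : p != 0 := gain_bisector_neq0 g.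
have rp : normc (p - a) < normc p.
  by rewrite -ltr_sqr ?nnegrE ?normc_ge0 // -subr_gt0 -gainE.
have qa : q - a = (1 - t)%:C * (p - a).
  by rewrite /q /p /b /bisector rmorphB rmorph1; field.
have pE : p = q + t%:C * (p - a).
  apply/eqP; rewrite -subr_eq0; apply/eqP.
  have -> : p - (q + t%:C * (p - a)) = (1 - t)%:C * (p - a) - (q - a).
    by rewrite rmorphB rmorph1; ring.
  by rewrite qa subrr.
have le_pq : normc p - t * normc (p - a) <= normc q.
  rewrite lerBlDr {1}pE (le_trans (le_normcD _ _)) //.
  by rewrite Normc.normcM normc_nng.
have q0 : q != 0.
  rewrite -normc_gt0 (lt_le_trans _ le_pq) // subr_gt0 (le_lt_trans _ rp) //.
  by rewrite ler_piMl ?normc_ge0.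
split=> //; rewrite !normc_one_sub_div // qa Normc.normcM.
rewrite normc_nng ?subr_ge0 //.
rewrite ler_pdivrMr ?normc_gt0 // mulrAC ler_pdivlMr ?normc_gt0 //.
(* (1 - t) |p| <= |p| - t |p - a| <= |q| *)
rewrite mulrAC mulrC ler_wpM2l ?normc_ge0 // (le_trans _ le_pq) //.
by rewrite mulrBl mul1r lerD2l lerN2 ler_wpM2l // ltW.
Qed.

End StepSize.

(** * The bisector and the symbol of the preconditioned operator *)

Section Bisector.
Variable R : realType.
Implicit Types (a b z p : R[i]) (s t l mu : R).
Local Notation normc := Normc.normc.

Lemma bisector_equidistant a b s :
  normc (bisector a b s - b) = normc (bisector a b s - a).
Proof.
apply/eqP; rewrite -(eqrXn2 (ltn0Sn 1)) ?normc_ge0 // !sqr_normc_ReIm bisectorE.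
case: a b => [a1 a2] [b1 b2] /=; apply/eqP.
by field.
Qed.

Lemma slit_plane_of_arg z :
  (exists2 t : R, - pi < t < pi & is_arg z t) ->
  complex.Im z != 0 \/ complex.Im z = 0 /\ 0 < complex.Re z.
Proof.
case=> t /andP[lo hi] [z0 zE].
have [Im0|] := eqVneq (complex.Im z) 0; [right | by left].
have n_gt0 : 0 < normc z by rewrite normc_gt0.
move: zE Im0; case: z z0 n_gt0 => x y z0.
set n := normc _ => n_gt0 /eqP; rewrite eq_complex /= !mul0r subr0 addr0.
move=> /andP[/eqP xE /eqP yE] y0.
have sin0 : sin t = 0.
  by apply/eqP; move/eqP: yE; rewrite y0 eq_sym mulf_eq0 gt_eqF.
suff t0 : t = 0 by rewrite y0 xE t0 cos0 mulr1.
apply/eqP; case: ltgtP => // t0.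
  have := @sin_gt0_pi R (- t).
  by rewrite sinN sin0 oppr0 ltxx oppr_gt0 t0 ltrNl lo => /(_ isT).
by have := @sin_gt0_pi R t; rewrite sin0 ltxx t0 hi => /(_ isT).
Qed.

Lemma GsymbolE z mu l : mu + l != 0 -> Gsymbol z mu l =
  ((complex.Re z + l) / (mu + l)) +i* (complex.Im z / (mu + l)).
Proof.
move=> ml0; rewrite /Gsymbol -rmorphD /= -fmorphV /=; case: z => x y.
by simpc.
Qed.

Lemma Gsymbol_gain_gt0 z mu l :
  complex.Im z != 0 \/ complex.Im z = 0 /\ 0 < complex.Re z ->
  0 < l -> 0 < mu + l -> exists s, 0 < gain (Gsymbol z mu l) 1 s.
Proof.
move=> zP l_gt0 ml_gt0; rewrite GsymbolE ?gt_eqF // /gain /=.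
case: zP => [y0|[-> x_gt0]].
  (* this parameter makes the gain equal to 1 *)
  exists ((mu + l - (complex.Re z + l)) / (2 * complex.Im z)).
  rewrite [ltRHS](_ : _ = 1) //; field.
  by rewrite y0 gt_eqF.
exists 0; rewrite !mulr0 !addr0 mulr1.
by rewrite divr_gt0 // addr_gt0.
Qed.

Lemma Gsymbol_segment z mu l1 l (t := (mu + l1) / (mu + l)) :
    0 < mu + l1 -> l1 <= l ->
  0 <= t <= 1 /\ Gsymbol z mu l = t%:C * Gsymbol z mu l1 + (1 - t)%:C.
Proof.
move=> ml1_gt0 le_l; have ml_gt0 : 0 < mu + l by lra.
split.
  by rewrite /t ler_pdivrMr // mul1r lerD2l le_l andbT divr_ge0 // ltW.
rewrite !GsymbolE ?gt_eqF // /t; case: z => x y; simpc.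
by apply/eqP; rewrite eq_complex /=; apply/andP; split; apply/eqP;
  field; rewrite !gt_eqF.
Qed.

(** The left side is convex in l and the right side is affine, so equality at
    the ends of the interval gives the inequality inside. *)
Lemma affine_norm_le (p q : R[i]) (k mu l1 l2 l : R) :
    l1 <= l <= l2 ->
    normc (p * l1%:C + q) = k * (l1 + mu) ->
    normc (p * l2%:C + q) = k * (l2 + mu) ->
  normc (p * l%:C + q) <= k * (l + mu).
Proof.
move=> /andP[l1l ll2] n1 n2.
have [l12|l12] := eqVneq l1 l2.
  by (have -> : l = l1 by lra); rewrite n1.
have d_gt0 : 0 < l2 - l1 by rewrite subr_gt0 lt_neqAle l12 (le_trans l1l).
rewrite -(ler_pM2l d_gt0) -{1}(normc_nng (ltW d_gt0)) -Normc.normcM.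
have -> : (l2 - l1)%:C * (p * l%:C + q) =
    (l2 - l)%:C * (p * l1%:C + q) + (l - l1)%:C * (p * l2%:C + q).
  by rewrite !rmorphB; ring.
rewrite (le_trans (le_normcD _ _)) // !Normc.normcM.
rewrite !normc_nng ?subr_ge0 // n1 n2.
by rewrite le_eqVlt; apply/orP; left; apply/eqP; ring.
Qed.

End Bisector.

(** * Hermitian operators and their eigenvalues *)

Section InvariantSubspaces.
Import passmx.
Variables (C : numClosedFieldType) (V : vectType C).
Implicit Types (A : 'End(V)) (U : {vspace V}).

Lemma leigenvalueP A l :
  reflect (exists2 v, v != 0 & A v = l *: v) (leigenvalue A l).
Proof.
have mem v : (v \in leigenspace A l) = (A v == l *: v).
  by rewrite memv_ker add_lfunE opp_lfunE scale_lfunE id_lfunE subr_eq0.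
apply: (iffP idP) => [nz|[v v0 Av]].
  exists (vpick (leigenspace A l)); first by rewrite vpick0.
  by apply/eqP; rewrite -mem memv_pick.
apply: contra v0 => /eqP eig0; move: (mem v).
by rewrite eig0 memv0 Av eqxx => ->.
Qed.

Lemma invariant_eigenvector A U : (A @: U <= U)%VS -> U != 0%VS ->
  exists2 v, v \in U & v != 0 /\ exists l, A v = l *: v.
Proof.
move=> AU U0.
pose B : 'End(subvs_of U) := (linfun (vsproj U) \o A \o linfun vsval)%VF.
have dimU : (0 < \dim {:subvs_of U})%N.
  by rewrite dimvf /dim /= lt0n dimv_eq0.
pose e := vbasis {:subvs_of U}.
have eb : basis_of {:subvs_of U} e := vbasisP _.
have [l /eigenvalueP[x xl x0]] := eigenvalue_closed (mxof e e B) dimU.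
pose v := vecof e x.
have v0 : v != 0 by rewrite vecof_eq0.
have Bv : B v = l *: v by rewrite (hom_vecof _ eb) xl linearZ.
exists (vsval v); first exact: subvsP.
split; first by apply: contraNneq v0 => v0; apply/eqP/val_inj; rewrite /= v0.
exists l; rewrite -linearZ -Bv /B !comp_lfunE /= !lfunE /= vsprojK //.
by apply: (subvP AU); apply: memv_img; apply: subvsP.
Qed.

Variable dot : {dot V for @Num.conj C}.

(** An inequality between the norms of two affine functions of a Hermitian
    operator holds as soon as it holds on the eigenvalues.  The induction splits
    an eigenvector v off an invariant subspace U; the orthogonal complement of v
    in U is again invariant, and Pythagoras separates the two contributions. *)
Lemma hermitian_affine_le A U (p q r t : C) (w : V) :
    (forall u v, dot (A u) v = dot u (A v)) ->
    (forall l, leigenvalue A l -> `|p * l + q| <= `|r * l + t|) ->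
    (A @: U <= U)%VS -> w \in U ->
  dot (p *: A w + q *: w) (p *: A w + q *: w)
    <= dot (r *: A w + t *: w) (r *: A w + t *: w).
Proof.
move=> Ah le_pr; have [n] := ubnP (\dim U).
elim: n U w => // n IHn U w; rewrite ltnS => dimU AU wU.
have [U0|U0] := eqVneq U 0%VS.
  by move: wU; rewrite U0 memv0 => /eqP ->; rewrite linear0 !scaler0 !addr0.
have [v vU [v0 [l Av]]] := invariant_eigenvector AU U0.
have vv0 : dot v v != 0 by rewrite dnorm_eq0.
pose U' := (U :&: orthov dot <[v]>)%VS.
have U'P u : (u \in U') = (u \in U) && (dot u v == 0).
  by rewrite memv_cap mem_orthov1.
have AU' : (A @: U' <= U')%VS.
  apply/subvP => _ /memv_imgP[u + ->]; rewrite !U'P => /andP[uU /eqP uv].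
  rewrite (subvP AU) ?memv_img //= Ah Av.
  by rewrite linearZr /= [X in _ * X]uv mulr0.
have dimU' : (\dim U' < n)%N.
  apply: leq_trans dimU; rewrite ltn_neqAle dimvS ?capvSl // andbT.
  apply/eqP => dimE.
  have : U' == U by rewrite eqEdim capvSl dimE leqnn.
  move=> /eqP U'U; move: vU; rewrite -U'U U'P => /andP[_].
  by rewrite (negPf vv0).
pose k := dot w v / dot v v; pose w' := w - k *: v.
have w'v : dot w' v = 0.
  by rewrite linearBl /= linearZl_LR /= divfK ?subrr.
have w'U' : w' \in U' by rewrite U'P w'v eqxx andbT memvB ?memvZ.
have Aw'v : dot (A w') v = 0 by rewrite Ah Av linearZr_LR /= w'v mulr0.
have wE : w = k *: v + w' by rewrite addrC subrK.
have normE (x y : C) : dot (x *: A w + y *: w) (x *: A w + y *: w)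
  = `|x * l + y| ^+ 2 * (`|k| ^+ 2 * dot v v)
    + dot (x *: A w' + y *: w') (x *: A w' + y *: w').
  have -> : x *: A w + y *: w
      = (x * l + y) *: (k *: v) + (x *: A w' + y *: w').
    have -> : A w = l *: (k *: v) + A w'.
      by rewrite {1}wE linearD linearZ /= Av !scalerA mulrC.
    rewrite wE !scalerDr [x *: (l *: _)]scalerA addrACA.
    by rewrite -scalerDl.
  have uv : dot (x *: A w' + y *: w') v = 0.
    by rewrite linearDl /= !linearZl_LR /= Aw'v w'v !mulr0 addr0.
  rewrite hnormDd; last first.
    apply/eqP; rewrite herm_eq0C; apply/eqP.
    by rewrite scalerA linearZr_LR /= [X in _ * X]uv mulr0.
  congr (_ + _); rewrite [LHS]dnormZ; congr (_ * _); exact: dnormZ.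
rewrite !normE lerD //; last exact: (IHn U').
rewrite ler_wpM2r ?mulr_ge0 ?exprn_ge0 ?dnorm_ge0 //.
rewrite lerXn2r ?nnegrE //; apply: le_pr.
by apply/leigenvalueP; exists v.
Qed.

End InvariantSubspaces.

(** * The operator norm *)

Section OperatorNorm.
Variables (R : realType) (V : vectType R[i]).
Variable dot : {dot V for @Num.conj R[i]}.
Local Notation normc := Normc.normc.

Lemma ipnorm_ge0 v : 0 <= ipnorm dot v.
Proof. exact: sqrtr_ge0. Qed.

Lemma ipnorm_gt0 v : (0 < ipnorm dot v) = (v != 0).
Proof.
rewrite sqrtr_gt0 -(dnorm_gt0 dot) ltcE /=.
have := dnorm_ge0 dot v; rewrite lecE /= => /andP[/eqP im _].
by rewrite im eqxx.
Qed.

Lemma ipnormZ x v : ipnorm dot (x *: v) = normc x * ipnorm dot v.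
Proof.
rewrite /ipnorm.
have -> : dot (x *: v) (x *: v) = (normc x ^+ 2)%:C * dot v v.
  by rewrite [LHS]dnormZ rmorphXn.
case: (dot v v) => r1 r2; simpc.
by rewrite sqrtrM ?sqr_ge0 // sqrtr_sqr ger0_norm ?normc_ge0.
Qed.

Lemma ipnorm_le u v : dot u u <= dot v v -> ipnorm dot u <= ipnorm dot v.
Proof. by rewrite lecE => /andP[_ ?]; apply: ler_wsqrtr. Qed.

(** A bound attained at one nonzero vector is the operator norm. *)
Lemma opnorm_eq (f : 'End(V)) (k : R) (e : V) :
    (forall v, ipnorm dot (f v) <= k * ipnorm dot v) ->
    e != 0 -> ipnorm dot (f e) = k * ipnorm dot e ->
  opnorm dot f = k.
Proof.
move=> fk e0 fe; have ne_gt0 : 0 < ipnorm dot e by rewrite ipnorm_gt0.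
have k0 : 0 <= k.
  by rewrite -(pmulr_lge0 _ ne_gt0) -fe ipnorm_ge0.
rewrite /opnorm; set E := (X in sup X).
have ubk : ubound E k.
  by move=> _ [v /= v1 <-]; rewrite (le_trans (fk v)) // ler_piMr.
pose x := ((ipnorm dot e)^-1)%:C.
have nx : normc x = (ipnorm dot e)^-1.
  by rewrite normc_nng // invr_ge0 ltW.
have kin : E k.
  exists (x *: e); rewrite /= ?linearZ ipnormZ nx ?mulVf ?gt_eqF //.
  by rewrite fe mulrCA mulVf ?mulr1 ?gt_eqF.
apply/le_anti/andP; split; first by apply: ge_sup => //; exists k.
by apply: ub_le_sup => //; exists k.
Qed.

End OperatorNorm.

(** * Preconditioned Richardson iteration *)

Section Preconditioned.
Variables (R : realType) (V : vectType R[i]).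
Variables (A : 'End(V)) (z : R[i]) (mu lambda1 : R).
Hypothesis hmu : - lambda1 < mu.
Hypothesis hl1 : is_smallest_eigenvalue A lambda1.

(** The preconditioner is a genuine inverse: a vector in the kernel of mu I + A
    would be an eigenvector for - mu < lambda1. *)
Lemma shift_lker0 : lker (mu%:C *: \1 + A)%VF == 0%VS.
Proof.
rewrite -subv0; apply/subvP => v; rewrite memv_ker memv0.
rewrite add_lfunE scale_lfunE id_lfunE => /eqP Sv; apply/negPn/negP => v0.
have /hl1.2 : passmx.leigenvalue A (- mu)%:C.
  apply/leigenvalueP; exists v => //.
  by rewrite rmorphN scaleNr; apply/eqP; rewrite -addr_eq0 addrC Sv.
by rewrite lecR leNgt ltrNl hmu.
Qed.

Lemma iteration_shiftE (alpha : R[i]) w :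
  iteration_op alpha (precond_op z mu A) (mu%:C *: w + A w)
    = (1 - alpha) *: A w + (mu%:C - alpha * z) *: w.
Proof.
have SE u : (mu%:C *: \1 + A)%VF u = mu%:C *: u + A u.
  by rewrite add_lfunE scale_lfunE id_lfunE.
rewrite /iteration_op /precond_op /precond add_lfunE opp_lfunE scale_lfunE.
rewrite id_lfunE comp_lfunE -[mu%:C *: w + A w]SE.
have -> : (z *: \1 + A)%VF ((mu%:C *: \1 + A)%VF w)
    = (mu%:C *: \1 + A)%VF (z *: w + A w).
  rewrite !SE !add_lfunE !scale_lfunE !id_lfunE !linearD !linearZ /=.
  by rewrite !addrA !scalerA [z * _]mulrC; congr (_ + _); rewrite addrAC.
rewrite lker0_lfunK ?shift_lker0 // SE !scalerBl scale1r scalerDr scalerA.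
by rewrite opprD addrACA [RHS]addrC -!addrA; congr (_ + _); rewrite addrCA.
Qed.

End Preconditioned.

(** The value at A = l of the affine function of [iteration_shiftE]. *)
Lemma affine_GsymbolE (R : realType) (z alpha : R[i]) (mu l : R) : 0 < mu + l ->
  Normc.normc ((1 - alpha) * l%:C + (mu%:C - alpha * z))
    = Normc.normc (1 - alpha * Gsymbol z mu l) * (l + mu).
Proof.
move=> ml_gt0; have lm_ge0 : 0 <= l + mu by rewrite addrC ltW.
rewrite -(normc_nng lm_ge0) -Normc.normcM; congr Normc.normc.
rewrite /Gsymbol rmorphD addrC.
by field; rewrite -rmorphD (inj_eq (@complexI R) _ 0) gt_eqF // addrC.
Qed.

Theorem theorem2p3 (R : realType) (z : R[i]) (lambda1 mu : R)
    (hz : exists2 t : R, - pi < t < pi & is_arg z t)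
    (hlambda1 : 0 < lambda1) (hmu : - lambda1 < mu) :
  exists2 c : R, c < 1 &
    forall (V : vectType R[i]) (dot : {dot V for @Num.conj R[i]})
        (A : 'End(V)) (lambdaN : R),
      is_hermitian_op dot A -> is_posdef_op dot A ->
      is_smallest_eigenvalue A lambda1 -> is_largest_eigenvalue A lambdaN ->
      let a := Gsymbol z mu lambda1 in
      let b := Gsymbol z mu lambdaN in
      (exists s : R, minimizes_Robj a b s) /\
      forall s : R, minimizes_Robj a b s ->
        let alpha := (bisector a b s)^-1 in
        error_reduction_factor dot alpha (precond_op z mu A)
          = Normc.normc (1 - alpha * a) /\
        Normc.normc (1 - alpha * a) <= c.
Proof.
have m1_gt0 : 0 < mu + lambda1 by lra.
have [s0 g0] := Gsymbol_gain_gt0 (slit_plane_of_arg hz) hlambda1 m1_gt0.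
exists (Normc.normc (1 - Gsymbol z mu lambda1
    / bisector (Gsymbol z mu lambda1) 1 s0)).
  by rewrite -gain_gt0E ?gain_bisector_neq0.
move=> V dot A lambdaN Ah _ hl1 hlN a b.
have le_1N : lambda1 <= lambdaN by rewrite -lecR; apply: hlN.2; apply: hl1.1.
have mN_gt0 : 0 < mu + lambdaN by lra.
have [t01 bE] := Gsymbol_segment z m1_gt0 le_1N.
have [q0 le_c] := bisector_ratio_le t01 g0.
rewrite -bE -/a -/b in q0 le_c.
have gb : 0 < gain a b s0.
  by rewrite gain_gt0E // (le_lt_trans le_c) // -gain_gt0E ?gain_bisector_neq0.
split; first exact: minimizes_Robj_exists gb.
move=> s [p0 le_s] alpha; set k := Normc.normc (1 - alpha * a).
have k_ge0 : 0 <= k := normc_ge0 _.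
have kE : k = Normc.normc (1 - a / bisector a b s) by rewrite /k mulrC.
split; last first.
  rewrite kE (le_trans _ le_c) // -ler_sqr ?nnegrE ?normc_ge0 //.
  exact: le_s.
have kb : k = Normc.normc (1 - alpha * b).
  by rewrite kE [alpha * b]mulrC !normc_one_sub_div // bisector_equidistant.
have affE l : lambda1 <= l <= lambdaN ->
    Normc.normc ((1 - alpha) * l%:C + (mu%:C - alpha * z)) <= k * (l + mu).
  move=> /affine_norm_le; apply; first by rewrite affine_GsymbolE.
  by rewrite affine_GsymbolE // kb.
have [e e0 Ae] := leigenvalueP _ _ hl1.1.
have SeE : mu%:C *: e + A e = (mu + lambda1)%:C *: e.
  by rewrite Ae -scalerDl rmorphD.
apply: (@opnorm_eq _ _ _ _ _ (mu%:C *: e + A e)).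
- (* v = (mu + A) w turns the bound into one between affine functions of A *)
  move=> v; pose S := (mu%:C *: \1 + A)%VF.
  have [w ->] : exists w, v = mu%:C *: w + A w.
    exists (S^-1%VF v).
    have : S (S^-1%VF v) = v by rewrite lker0_lfunVK // (shift_lker0 hmu hl1).
    by rewrite {1}/S add_lfunE scale_lfunE id_lfunE => ->.
  rewrite (iteration_shiftE _ hmu hl1) -{1}(normc_nng k_ge0) -ipnormZ.
  apply: ipnorm_le; rewrite scalerDr [in leRHS]addrC scalerA.
  apply: (hermitian_affine_le Ah (U := fullv)); rewrite ?subvf ?memvf //.
  move=> w' w'eig; have w'1 := hl1.2 _ w'eig; have w'N := hlN.2 _ w'eig.
  have [l w'E] : exists l, w' = l%:C.
    exists (complex.Re w'); move: w'1; rewrite lecE /= => /andP[/eqP].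
    by case: w' {w'eig w'N} => x y /= ->.
  rewrite w'E !lecR in w'1 w'N *.
  have -> : k%:C * l%:C + k%:C * mu%:C = (k * (l + mu))%:C.
    by rewrite rmorphM rmorphD mulrDr.
  have := affE l; rewrite w'1 w'N => /(_ isT) affl.
  by rewrite normc_nng // mulr_ge0 //; lra.
- by rewrite SeE scaler_eq0 negb_or e0 (inj_eq (@complexI R) _ 0) gt_eqF.
rewrite (iteration_shiftE _ hmu hl1) SeE Ae scalerA -scalerDl !ipnormZ.
rewrite affine_GsymbolE // -/k -mulrA [mu + _]addrC normc_nng //.
by lra.
Qed.
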